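(* Let $\mathbf R,\mathbf S>0$, $v>0$ and $\beta^0,\rho^0\in[0,1]$ with $\beta^0+\rho^0=1$. Let $(\overline{\mathfrak C}(t))_{t\ge0}$ be the linearized mean field cooperator wealth process, let $q_0\in[0,\infty)$, and set $$\mathfrak m:=v\,(\beta^0\mathbf R-\rho^0\mathbf S),\qquad \sigma^2:=v\,(\beta^0\mathbf R^2+\rho^0\mathbf S^2).$$ Then for all $\eta>0$ and all $t\ge0$, $$\mathbb P_{q_0}\Big(\overline{\mathfrak C}(t)\in\big[q_0+\mathfrak m t-\eta\sqrt{\sigma^2t},\ q_0+\mathfrak m t+\eta\sqrt{\sigma^2t}\big]\Big)\ge 1-\eta^{-2}.$$ Moreover, for all $\eta>0$, all $t\ge0$ and all $\tau$ such that $\tau<q_0-\dfrac{\eta^2\sigma^2}{4\mathfrak m}$, $$\mathbb P_{q_0}\big(\overline{\mathfrak C}(t)>\tau\big)\ge 1-\eta^{-2}.$$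
   Context: The linearized mean field cooperator wealth process $(\overline{\mathfrak C}(t))_{t\ge0}$ is the real-valued pure jump process which, under $\mathbb P_{q_0}$, starts from $\overline{\mathfrak C}(0)=q_0$, is constant between consecutive times of $(t_n)_{n\ge1}$, where $(t_n)_{n\ge 1}$ are the jump times of a Poisson process of intensity $v$, and satisfies, at the $n$-th time, $\overline{\mathfrak C}(t_n)-\overline{\mathfrak C}(t_{n-1})=\overline U(n)$ (with $t_0=0$), where $(\overline U(n))_{n\ge1}$ are i.i.d., independent of the Poisson process, with $\overline U(n)=-\mathbf S$ with probability $\rho^0$, $\overline U(n)=\mathbf R$ with probability $\beta^0$, and $\overline U(n)=0$ with probability $1-\beta^0-\rho^0$ (which is $0$ since $\beta^0+\rho^0=1$).
   Formalization: The second bound is stated only for 𝔪 > 0: for 𝔪 = 0 the expression η²σ²/(4𝔪) is undefined, and for 𝔪 < 0 the claim is false (t = 0, τ = q₀, η = 2 gives probability 0 < 3/4). *)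

(* Defs.v *)
From HB Require Import structures.
From mathcomp Require Import all_boot all_order all_algebra.
From mathcomp Require Import all_classical all_reals all_analysis.
Set Implicit Arguments.
Unset Strict Implicit.
Unset Printing Implicit Defensive.
Import Order.TTheory GRing.Theory Num.Theory.
Import numFieldNormedType.Exports.
Local Open Scope classical_set_scope.
Local Open Scope ring_scope.

Section independence.
Context {d : measure_display} {T : measurableType d} {R : realType}.
Variable P : probability T R.

Definition mutually_independent {I : choiceType} {d'} {E : measurableType d'}
    (X : I -> T -> E) : Prop :=
  forall (J : seq I) (A : I -> set E), uniq J ->
    (forall j, measurable (A j)) ->
    P [set w | forall j, j \in J -> A j (X j w)] =
    (\prod_(j <- J) P (X j @^-1` A j))%E.

Definition sigma_of {I : Type} {d'} {E : measurableType d'}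
    (D : set I) (X : I -> T -> E) : set (set T) :=
  <<s \bigcup_(i in D) preimage_set_system setT (X i) measurable >>.

Definition independent_classes (F G : set (set T)) : Prop :=
  forall A B, F A -> G B -> P (A `&` B) = (P A * P B)%E.

End independence.

Section poisson.
Context {d : measure_display} {T : measurableType d} {R : realType}.
Variable P : probability T R.

(* The subtraction is truncated, which only matters on a null event: the paths
   of the processes considered below are almost surely nondecreasing. *)
Definition increment (N : R -> {RV P >-> nat}) (s t : R) (w : T) : nat :=
  (N t w - N s w)%N.

(* [N] is the counting process, [tau n] its [n]-th jump time ([tau 0] being the
   initial time and not a jump).  Almost surely, the jump times increase
   strictly and [N t] is the number of jump times in ]0, t]; this entails
   [N 0 = 0] and right-continuous nondecreasing paths with unit jumps. *)
Record poisson_process (v : R) (N : R -> {RV P >-> nat})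
    (tau : nat -> {RV P >-> R}) : Prop := PoissonProcess {
  jump_timesP : {ae P, forall w,
    [/\ tau 0%N w = 0,
        forall n, tau n w < tau n.+1 w
      & forall n t, 0 <= t -> (n <= N t w)%N = (tau n w <= t)] };
  increments_independent : forall (n : nat) (s : nat -> R),
    0 <= s 0%N -> (forall i, s i <= s i.+1) ->
    mutually_independent P (fun i : 'I_n => increment N (s i) (s i.+1));
  increments_poisson : forall (s t : R) (k : nat), 0 <= s -> s < t ->
    P [set w | increment N s t w = k] = (poisson_pmf (v * (t - s)) k)%:E
}.

End poisson.

Section wealth.
Context {d : measure_display} {T : measurableType d} {R : realType}.
Variable P : probability T R.

(* [gain], [loss] stand for the amounts R and S.  The sequence of jump sizes is
   indexed from 0: [U n] is the jump at the time [tau n.+1]. *)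
Record wealth_dynamics (gain loss v beta rho q0 : R) (N : R -> {RV P >-> nat})
    (tau U : nat -> {RV P >-> R}) (C : R -> {RV P >-> R}) : Prop :=
  WealthDynamics {
  wealth_clock : poisson_process v N tau;
  wealth_steps_independent : mutually_independent P (fun n => U n : T -> R);
  wealth_step_loss : forall n, P [set w | U n w = - loss] = rho%:E;
  wealth_step_gain : forall n, P [set w | U n w = gain] = beta%:E;
  wealth_step_null : forall n, P [set w | U n w = 0] = (1 - beta - rho)%:E;
  wealth_steps_clock_independent : independent_classes P
    (sigma_of setT (fun n => U n : T -> R))
    (sigma_of [set t : R | 0 <= t] (fun t => N t : T -> nat));
  wealth_path : {ae P, forall w,
    [/\ C 0 w = q0,
        forall n t, tau n w <= t < tau n.+1 w -> C t w = C (tau n w) w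
      & forall n, C (tau n.+1 w) w - C (tau n w) w = U n w] }
}.

(* The process is indexed by all of R, but its values at negative times are
   left unconstrained. *)
Definition linearized_cooperator_wealth (gain loss v beta rho q0 : R)
    (C : R -> {RV P >-> R}) : Prop :=
  exists (N : R -> {RV P >-> nat}) (tau U : nat -> {RV P >-> R}),
    wealth_dynamics gain loss v beta rho q0 N tau U C.

End wealth.

(* Main.v *)
(* At a fixed time t > 0 the wealth is almost surely q0 plus the sum of the first
   N t steps, so Chebyshev's inequality with the second moment of this sum about
   m t gives the first bound.  Since the steps take two values, the sample space
   is covered, up to a null set, by the events {N t = n, first n steps = s} with
   s a word of length n over two letters.  Their probabilities are given by
   independence, and the union bound restricted to the words with a large
   deviation replaces any use of expectations:
     sum_n P(N t = n) (n (E U^2 - (E U)^2) + (n E U - v t E U)^2) = v t E U^2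
   by the factorial moments of the Poisson law.  For the second bound, the lower
   end of the interval is a quadratic polynomial in the square root of t, with
   minimum q0 - eta^2 sigma2 / (4 m). *)

Require Import Defs.
From mathcomp Require Import all_boot all_order all_algebra.
From mathcomp Require Import all_classical all_reals all_analysis.
From mathcomp Require Import ring lra.
Import Order.TTheory GRing.Theory Num.Theory.
Import numFieldNormedType.Exports.
Local Open Scope classical_set_scope.
Local Open Scope ring_scope.

(** * Two-letter words and moments of the Poisson law *)

Fixpoint bool_words (n : nat) : seq bitseq :=
  if n is n'.+1 then
    map (cons true) (bool_words n') ++ map (cons false) (bool_words n')
  else [:: [::]].

Lemma mem_bool_words (s : bitseq) : s \in bool_words (size s).
Proof.
elim: s => //= b s IHs; rewrite mem_cat; apply/orP.
by case: b; [left|right]; rewrite map_f.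
Qed.

(** Variance plus squared bias for a sum of [n] independent letters, as a purely algebraic identity.
    The induction needs [c] general: a first letter [b] contributes the factor [p b] and replaces
    [c] by [c - x b]. *)
Lemma second_moment_bool_words {R : comPzRingType} (p x : bool -> R) (c : R)
    (n : nat) : p true + p false = 1 ->
  let mean := p true * x true + p false * x false in
  let square_mean := p true * x true ^+ 2 + p false * x false ^+ 2 in
  \sum_(s <- bool_words n)
     (\prod_(b <- s) p b) * (\sum_(b <- s) x b - c) ^+ 2 =
  n%:R * (square_mean - mean ^+ 2) + (n%:R * mean - c) ^+ 2.
Proof.
move=> p1 /=; elim: n c => [|n IHn] c /=.
  by rewrite big_seq1 !big_nil; ring.
rewrite big_cat !big_map /=.
have split b (s : bitseq) : (\prod_(b' <- b :: s) p b') *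
    (\sum_(b' <- b :: s) x b' - c) ^+ 2 =
    p b * ((\prod_(b' <- s) p b') * (\sum_(b' <- s) x b' - (c - x b)) ^+ 2).
  by rewrite !big_cons; ring.
under eq_bigr do rewrite split; under [X in _ + X]eq_bigr do rewrite split.
rewrite -!mulr_sumr !IHn -natr1.
have -> : p true = 1 - p false by rewrite -p1 addrK.
ring.
Qed.

(** The terms with [n < k] vanish. For [n = i + k] the falling factorial cancels against [n!], which
    leaves [r ^+ k * expR (- r)] times the exponential series. *)
Lemma cvg_poisson_factorial_moment {R : realType} (r : R) (k : nat) : 0 < r ->
  series (fun n => poisson_pmf r n * (n ^_ k)%:R) @ \oo --> r ^+ k.
Proof.
move=> r0; rewrite -(cvg_shiftn k) /=.
have -> : (fun n => series (fun n => poisson_pmf r n * (n ^_ k)%:R) (n + k)%N) =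
    (fun n => r ^+ k * expR (- r) * series (exp_coeff r) n).
  apply/funext => n; rewrite /series /= (@big_cat_nat _ _ _ k) ?leq_addl //=.
  rewrite big_nat_cond big1 ?add0r; last first.
    by move=> i; rewrite andbT => /andP[_ ik]; rewrite ffact_small ?mulr0.
  rewrite -{1}(add0n k) big_addn addnK mulr_sumr; apply: eq_bigr => i _.
  rewrite /poisson_pmf r0 /exp_coeff /= -(@ffact_fact (i + k) k) ?leq_addl //.
  rewrite addnK natrM exprD.
  have : ((i + k) ^_ k)%:R != 0 :> R by rewrite pnatr_eq0 -lt0n ffact_gt0 leq_addl.
  have : (i`!)%:R != 0 :> R by rewrite pnatr_eq0 -lt0n fact_gt0.
  by move=> ? ?; field; apply/andP.
have {2}-> : r ^+ k = r ^+ k * expR (- r) * expR r.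
  by rewrite -mulrA expRN mulVf ?mulr1 // gt_eqF ?expR_gt0.
by apply: cvgMl_tmp; exact: is_cvg_series_exp_coeff.
Qed.

(** The summand is quadratic in [n]. Expanding it in the basis n(n-1), n, 1 reduces the limit to the
    factorial moments of orders 2, 1 and 0. *)
Lemma cvg_poisson_compound_second_moment {R : realType} (r mean square_mean : R) :
  0 < r ->
  series (fun n => poisson_pmf r n *
    (n%:R * (square_mean - mean ^+ 2) + (n%:R * mean - r * mean) ^+ 2)) @ \oo
  --> r * square_mean.
Proof.
move=> r0.
pose S k := series (fun n => poisson_pmf r n * (n ^_ k)%:R).
have -> : series (fun n => poisson_pmf r n *
    (n%:R * (square_mean - mean ^+ 2) + (n%:R * mean - r * mean) ^+ 2)) =
    (fun n => mean ^+ 2 * S 2 n + (square_mean - 2 * r * mean ^+ 2) * S 1 n +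
              (r * mean) ^+ 2 * S 0 n).
  apply/funext => n; rewrite /S /series /= !mulr_sumr -!big_split /=.
  apply: eq_bigr => i _; rewrite ffactn0 ffactn1.
  have -> : (i ^_ 2)%:R = i%:R * (i%:R - 1) :> R.
    by case: i => [|i]; rewrite ?mul0r // !ffactSS ffactn1 natrM -natr1 addrK.
  ring.
have -> : r * square_mean = mean ^+ 2 * r ^+ 2 +
    (square_mean - 2 * r * mean ^+ 2) * r ^+ 1 + (r * mean) ^+ 2 * r ^+ 0.
  ring.
by apply: cvgD; [apply: cvgD|]; apply: cvgMl_tmp; exact: cvg_poisson_factorial_moment.
Qed.

Lemma content_bigsetU_le {d : measure_display} {T : ringOfSetsType d}
    {R : realFieldType} (mu : {content set T -> \bar R}) {I : Type} (s : seq I)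
    (F : I -> set T) : (forall i, measurable (F i)) ->
  (mu (\big[setU/set0]_(i <- s) F i) <= \sum_(i <- s) mu (F i))%E.
Proof.
move=> mF; elim: s => [|i s IHs]; first by rewrite !big_nil measure0.
rewrite !big_cons; apply: le_trans (measureU2 _ _ _) _ => //.
  exact: bigsetU_measurable.
exact: leeD2l.
Qed.

(** * Random walk with a Poisson number of steps *)

Section random_walk.
Context {d : measure_display} {T : measurableType d} {R : realType}.
Context (P : probability T R).

Lemma sigma_of_preimage {I : Type} {d'} {E : measurableType d'} (D : set I)
    (X : I -> T -> E) (i : I) (A : set E) :
  D i -> measurable A -> sigma_of D X (X i @^-1` A).
Proof.
move=> Di mA; apply: sub_sigma_algebra; exists i => //.
by exists A => //; rewrite setTI.
Qed.

(** Puts the event that the first steps spell a given word into the sigma-algebra of the steps,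
    where independence from the clock applies. *)
Lemma sigma_of_seq {I : eqType} {d'} {E : measurableType d'} (D : set I)
    (X : I -> T -> E) (J : seq I) (A : I -> set E) :
  (forall j, D j) -> (forall j, measurable (A j)) ->
  sigma_of D X [set w | forall j, j \in J -> A j (X j w)].
Proof.
move=> DT mA; pose G := \bigcup_(i in D) preimage_set_system setT (X i) measurable.
elim: J => [|i J IHJ].
  rewrite [X in sigma_of _ _ X](_ : _ = setT); last by apply/seteqP; split.
  exact: (@measurableT _ (g_sigma_algebraType G)).
rewrite [X in sigma_of _ _ X](_ : _ =
    (X i @^-1` A i) `&` [set w | forall j, j \in J -> A j (X j w)]).
  apply: (@measurableI _ (g_sigma_algebraType G)) => //.
  exact: sigma_of_preimage.
apply/seteqP; split=> [w Xw|w [Xi Xw] j].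
  by split=> [|j jJ]; apply: Xw; rewrite inE ?eqxx ?jJ ?orbT.
by rewrite inE => /predU1P[->|/Xw].
Qed.

(** Shaped like the event in [mutually_independent], with [iota 0 (size s)] as index list, so that
    independence applies directly. The default [false] of [nth] is never reached. *)
Definition follows_word (X : nat -> T -> R) (x : bool -> R) (s : bitseq) : set T :=
  [set w | forall j, j \in iota 0 (size s) -> X j w = x (nth false s j)].

Lemma probability_follows_word (X : nat -> T -> R) (p x : bool -> R)
    (s : bitseq) :
  mutually_independent P X ->
  (forall n b, P [set w | X n w = x b] = (p b)%:E) ->
  P (follows_word X x s) = (\prod_(b <- s) p b)%:E.
Proof.
move=> indepX pX.
rewrite (indepX (iota 0 (size s)) (fun j => [set x (nth false s j)])).
- rewrite (big_nth false) /index_iota subn0 -prodEFin.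
  by apply: eq_bigr => j _; exact: pX.
- exact: iota_uniq.
- by move=> j; exact: measurable_set1.
Qed.

Lemma measurable_follows_word (X : nat -> {RV P >-> R}) (x : bool -> R)
    (s : bitseq) : measurable (follows_word (fun n => X n) x s).
Proof.
rewrite [X in measurable X](_ : _ = \bigcap_(j in [set` iota 0 (size s)])
    (X j @^-1` [set x (nth false s j)])); last first.
  by apply/seteqP; split.
apply: bigcap_measurableType => j _.
by apply: measurable_funPTI; exact: measurable_set1.
Qed.

(** The two level sets are disjoint and their probabilities add up to 1, so the complement of their
    union is null. *)
Lemma ae_two_values (Y : {RV P >-> R}) (p x : bool -> R) :
  x true != x false -> p true + p false = 1 ->
  (forall b, P [set w | Y w = x b] = (p b)%:E) ->
  {ae P, forall w, exists b, Y w = x b}.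
Proof.
move=> x_inj p1 pY.
have mY b : measurable [set w | Y w = x b].
  exact: (measurable_funPTI Y (measurable_set1 (x b))).
exists (~` ([set w | Y w = x true] `|` [set w | Y w = x false])).
split.
- by apply: measurableC; exact: measurableU.
- rewrite probability_setC; last exact: measurableU.
  suff -> : P ([set w | Y w = x true] `|` [set w | Y w = x false]) =
      (p true + p false)%:E by rewrite p1 subee.
  rewrite EFinD -!pY; apply: measureU => //.
  by apply/seteqP; split=> // w [/= ->] /eqP; exact/negP.
- by move=> w /= nY [] Yw; apply: nY; [exists true|exists false].
Qed.

(** Here [r * mean] and [r * square_mean] are the mean and variance of the compound Poisson sum.
    Taking any measurable [B] that lies almost surely in the deviation event avoids proving that the
    random sum is measurable. [G] stands for the sigma-algebra of the clock. *)
Lemma poisson_random_walk_chebyshev (X : nat -> {RV P >-> R})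
    (K : {RV P >-> nat}) (G : set (set T)) (p x : bool -> R) (r a : R)
    (B : set T) :
  let mean := p true * x true + p false * x false in
  let square_mean := p true * x true ^+ 2 + p false * x false ^+ 2 in
  0 < r -> 0 < a -> (forall b, 0 <= p b) -> p true + p false = 1 ->
  x true != x false ->
  mutually_independent P (fun n => X n : T -> R) ->
  (forall n b, P [set w | X n w = x b] = (p b)%:E) ->
  (forall k, P [set w | K w = k] = (poisson_pmf r k)%:E) ->
  independent_classes P (sigma_of setT (fun n => X n : T -> R)) G ->
  (forall k, G [set w | K w = k]) ->
  measurable B ->
  {ae P, forall w, B w -> a < `|\sum_(i < K w) X i w - r * mean|} ->
  (P B <= (r * square_mean / a ^+ 2)%:E)%E.
Proof.
move=> mean square_mean r0 a0 p0 p1 x_inj indepX pX pK indepXK GK mB aeB.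
have aeX : {ae P, forall w, forall n, exists b, X n w = x b}.
  apply: ae_foralln => n; exact: ae_two_values (pX n).
case: (filterI aeB aeX) => Z [mZ PZ subZ].
pose dev (s : bitseq) := `|\sum_(b <- s) x b - r * mean|.
pose F n s := follows_word (fun n => X n) x s `&` [set w | K w = n].
pose big n := \big[setU/set0]_(s <- [seq s <- bool_words n | a < dev s]) F n s.
have mF n s : measurable (F n s).
  apply: measurableI; first exact: measurable_follows_word.
  exact: (@measurable_funPTI _ _ _ _ K [set n]).
have mbig n : measurable (big n) by exact: bigsetU_measurable.
have mass_ge0 (s : bitseq) : 0 <= \prod_(b <- s) p b by exact: prodr_ge0.
have Pbig n : (P (big n) <= (poisson_pmf r n * (n%:R * (square_mean - mean ^+ 2) +
      (n%:R * mean - r * mean) ^+ 2) / a ^+ 2)%:E)%E.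
  apply: le_trans (content_bigsetU_le _ _ _ (mF n)) _.
  rewrite /mean /square_mean -second_moment_bool_words //.
  rewrite -/mean big_filter mulr_sumr mulr_suml -sumEFin big_mkcond /=.
  (* A word with a small deviation counts 0 on the left and a nonnegative weight on the right. *)
  apply: lee_sum => s _; case: ifPn => [big_s|_]; last first.
    rewrite lee_fin divr_ge0 ?sqr_ge0 // mulr_ge0 ?poisson_pmf_ge0 //.
    by rewrite mulr_ge0 ?sqr_ge0.
  have -> : P (F n s) =
      (P (follows_word (fun n => X n) x s) * P [set w | K w = n])%E.
    apply: indepXK => //.
    by apply: (sigma_of_seq setT (fun n => X n : T -> R) _
      (fun j => [set x (nth false s j)])).
  rewrite (probability_follows_word _ p) // pK -EFinM lee_fin mulrC -!mulrA.
  (* Once the common factors are removed, what is left is [1 <= dev s ^+ 2 / a ^+ 2], which follows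
     from [a < dev s]. *)
  rewrite ler_wpM2l ?poisson_pmf_ge0 // ler_peMr //.
  rewrite mulrA -expr2 ler_pdivlMr ?exprn_gt0 // mul1r.
  rewrite -[leRHS]real_normK ?num_real //.
  by apply: lerXn2r; rewrite ?nnegrE ?normr_ge0 ?(ltW a0) ?(ltW big_s).
have subB : B `<=` Z `|` \bigcup_n big n.
  move=> w Bw; have [Zw|nZw] := pselect (Z w); [by left|right].
  have /contrapT[/(_ Bw) dev_w Xw] : ~ ~ _ := contra_not (subZ w) nZw.
  (* The word read off the first [K w] steps. A step different from [x true] equals [x false]
     because [w] is outside [Z]. *)
  pose s := mkseq (fun n => X n w == x true) (K w).
  have nth_s j : (j < K w)%N -> x (nth false s j) = X j w.
    by move=> jK; rewrite nth_mkseq //; case: eqP => // nX; case: (Xw j) => -[].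
  exists (K w) => //; rewrite /big -bigcup_seq /=; exists s.
    rewrite /= mem_filter; apply/andP; split; last first.
      by have := mem_bool_words s; rewrite {2}/s size_mkseq.
    rewrite /dev (big_nth false) size_mkseq big_mkord.
    by under eq_bigr do rewrite nth_s //.
  split=> // j; rewrite mem_iota size_mkseq => /nth_s -> //.
have mU : measurable (\bigcup_n big n) by exact: bigcup_measurable.
have PZU : (P (Z `|` \bigcup_n big n) <= P (\bigcup_n big n))%E.
  by rewrite setUC le_eqVlt; apply/orP; left; apply/eqP; exact: measureU0.
apply: le_trans (le_measure P _ _ subB) _; rewrite ?inE //.
  exact: measurableU.
apply: le_trans PZU _.
apply: le_trans (measure_sigma_subadditive P mbig mU _) _ => //.
apply: le_trans (lee_nneseries _ (fun n _ => Pbig n)) _ => //.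
rewrite le_eqVlt; apply/orP; left; apply/eqP/cvg_lim => //.
apply: cvg_EFin.
  by apply: nearW => n; rewrite sumEFin.
rewrite (_ : fine \o _ = (fun n => series (fun n => poisson_pmf r n *
    (n%:R * (square_mean - mean ^+ 2) + (n%:R * mean - r * mean) ^+ 2)) n *
    a ^- 2)).
  by apply: cvgMr_tmp; exact: cvg_poisson_compound_second_moment.
by apply/funext => n; rewrite /= sumEFin /= /series /= mulr_suml.
Qed.
End random_walk.

(** * Reduction of the wealth process to the random walk *)

Section jump_process.
Context {d : measure_display} {T : measurableType d} {R : realType}.
Context (P : probability T R).

Lemma le_probability_ae (A B : set T) : measurable A -> measurable B ->
  {ae P, forall w, A w -> B w} -> (P A <= P B)%E.
Proof.
move=> mA mB [Z [mZ PZ subZ]].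
have subA : A `<=` B `|` Z.
  move=> w Aw; have [Bw|nBw] := pselect (B w); first by left.
  by right; apply: subZ => /= /(_ Aw).
apply: le_trans (le_measure P _ _ subA) _; rewrite ?inE //.
  exact: measurableU.
by rewrite le_eqVlt; apply/orP; left; apply/eqP; exact: measureU0.
Qed.

(** The process is specified through the law of its increments; on ]0, t] the increment is almost
    surely [N t], since [N 0] vanishes almost surely. *)
Lemma poisson_process_marginal (v : R) (N : R -> {RV P >-> nat})
    (tau : nat -> {RV P >-> R}) (t : R) (k : nat) :
  poisson_process v N tau -> 0 < t ->
  P [set w | N t w = k] = (poisson_pmf (v * t) k)%:E.
Proof.
move=> [jumps _ incr] t0; rewrite -{2}(subr0 t) -(incr 0 t k (lexx 0) t0).
have mN : measurable [set w | N t w = k].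
  exact: (@measurable_funPTI _ _ _ _ (N t) [set k]).
have mI : measurable [set w | increment N 0 t w = k].
  rewrite [X in measurable X](_ : _ = \bigcup_n
    (N 0 @^-1` [set n] `&` N t @^-1` [set m | (m - n)%N = k])).
    by apply: bigcup_measurable => n _; apply: measurableI; exact: measurable_funPTI.
  apply/seteqP; split=> [w Iw|w [n _ [/= Nw Iw]]]; first by exists (N 0 w).
  by rewrite /increment Nw.
have ae_eq : {ae P, forall w, increment N 0 t w = N t w}.
  apply: filterS jumps => w [tau0 lt_tau countN].
  suff -> : increment N 0 t w = (N t w - 0)%N by rewrite subn0.
  (* A jump counted at time 0 would give [tau 1 <= 0 = tau 0], against the strict increase of the
     jump times. *)
  congr subn; apply/eqP; rewrite -leqn0 leqNgt countN // -ltNge.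
  by rewrite -[ltLHS]tau0.
apply/eqP; rewrite eq_le; apply/andP; split; apply: le_probability_ae => //.
  by apply: filterS ae_eq => w /= ->.
by apply: filterS ae_eq => w /= ->.
Qed.

Lemma wealth_random_walk {gain loss v beta rho q0 : R} {N : R -> {RV P >-> nat}}
    {tau U : nat -> {RV P >-> R}} {C : R -> {RV P >-> R}} (t : R) :
  wealth_dynamics gain loss v beta rho q0 N tau U C -> 0 <= t ->
  {ae P, forall w, C t w = q0 + \sum_(i < N t w) U i w}.
Proof.
move=> HC t0; apply: filterS2 (jump_timesP (wealth_clock HC)) (wealth_path HC).
move=> w [tau0 lt_tau countN] [C0 C_const C_jump].
(* [countN] at [N t w] and at its successor places [t] between these two consecutive jump times, so
   [C t] is the wealth just after the last jump. The jumps then telescope. *)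
rewrite (C_const (N t w)); last by rewrite -countN // leqnn ltNge -countN // ltnn.
elim: (N t w) => [|n IHn]; first by rewrite big_ord0 addr0 tau0.
by rewrite big_ord_recr /= addrA -IHn -(C_jump n) subrKC.
Qed.

Lemma wealth_concentration (gain loss v beta rho q0 : R)
    (C : R -> {RV P >-> R}) (eta t : R) :
  0 < gain -> 0 < loss -> 0 < v -> 0 <= beta -> 0 <= rho -> beta + rho = 1 ->
  linearized_cooperator_wealth gain loss v beta rho q0 C ->
  let m := v * (beta * gain - rho * loss) in
  let sigma2 := v * (beta * gain ^+ 2 + rho * loss ^+ 2) in
  0 < eta -> 0 <= t ->
  ((1 - eta ^- 2)%:E <=
   P [set w | (q0 + m * t - eta * Num.sqrt (sigma2 * t) <= C t w <=
               q0 + m * t + eta * Num.sqrt (sigma2 * t))%R])%E.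
Proof.
move=> gain0 loss0 v0 beta0 rho0 beta_rho [N [tau [U HC]]] m sigma2 eta0 t0.
set a := eta * _.
have sigma2_gt0 : 0 < sigma2.
  rewrite mulr_gt0 //; have [beta_gt0|beta_le0] := ltP 0 beta.
    by rewrite ltr_pwDl ?mulr_gt0 ?exprn_gt0 // mulr_ge0 // sqr_ge0.
  by rewrite ltr_wpDl ?mulr_gt0 ?exprn_gt0 ?mulr_ge0 ?sqr_ge0 //; lra.
pose A := C t @^-1` `[q0 + m * t - a, q0 + m * t + a].
have -> : [set w | q0 + m * t - a <= C t w <= q0 + m * t + a] = A.
  by apply/seteqP; split=> w; rewrite /A /= in_itv.
have mA : measurable A by exact: measurable_funPTI.
(* At time 0 the Poisson parameter and the half-width [a] both vanish, so the Chebyshev bound does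
   not apply; the interval is then the point [q0], where the wealth starts almost surely. *)
have [t_eq0|t_neq0] := eqVneq t 0.
  apply: (@le_trans _ _ 1%E); first by rewrite lee_fin gerBl invr_ge0 sqr_ge0.
  rewrite -(probability_setT P); apply: le_probability_ae => //.
  apply: filterS (wealth_path HC) => w [C0 _ _] _.
  rewrite /A /a t_eq0 /= in_itv /= C0 !mulr0 sqrtr0 mulr0 subr0 !addr0.
  exact/andP.
have t_gt0 : 0 < t by rewrite lt_neqAle eq_sym t_neq0.
have a_gt0 : 0 < a by rewrite mulr_gt0 // sqrtr_gt0 mulr_gt0.
pose p b := if b then beta else rho.
pose x b := if b then gain else - loss.
have PAC : (P (~` A) <= (v * t * (p true * x true ^+ 2 + p false * x false ^+ 2)
    / a ^+ 2)%:E)%E.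
  apply: (@poisson_random_walk_chebyshev _ _ _ P U (N t)
    (sigma_of [set t : R | 0 <= t] (fun t => N t : T -> nat)) p x) => //.
  - exact: mulr_gt0.
  - by case.
  - by rewrite /x gt_eqF //; lra.
  - exact: wealth_steps_independent HC.
  - by move=> n []; [exact: wealth_step_gain HC n|exact: wealth_step_loss HC n].
  - by move=> k; exact: poisson_process_marginal (wealth_clock HC) _.
  - exact: wealth_steps_clock_independent HC.
  - by move=> k; exact: (sigma_of_preimage _ (fun t => N t : T -> nat) t [set k]).
  - exact: measurableC.
  (* The centre [v * t * mean] is [m * t], and leaving a closed interval means a deviation strictly
     larger than [a]. *)
  - apply: filterS (wealth_random_walk t HC t0) => w Cw.
    rewrite /A /= in_itv /= Cw /p /x => /negP; apply: contraNT; rewrite -leNgt.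
    by rewrite /m; move=> /ler_normlP[]; lra.
have second_moment : v * t * (p true * x true ^+ 2 + p false * x false ^+ 2) /
    a ^+ 2 = eta ^- 2.
  rewrite /p /x sqrrN /a exprMn sqr_sqrtr ?(mulr_ge0 (ltW sigma2_gt0)) //.
  have := sigma2_gt0; rewrite /sigma2 pmulr_rgt0 // => sq_gt0.
  by field; rewrite !gt_eqF.
apply: (@le_trans _ _ (1 - P (~` A))%E).
  by rewrite EFinB leeB // -second_moment.
by rewrite -probability_setC ?setCK //; exact: measurableC.
Qed.
End jump_process.

(** The second bound assumes [0 < m]: its threshold is the minimum over time of the lower end of the
    interval, which tends to minus infinity when [m <= 0]. *)
Theorem proposition3p4 (R : realType) (d : measure_display)
    (T : measurableType d) (P : probability T R)
    (gain loss v beta rho q0 : R) (C : R -> {RV P >-> R})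
    (gain_gt0 : 0 < gain) (loss_gt0 : 0 < loss) (v_gt0 : 0 < v)
    (beta01 : 0 <= beta <= 1) (rho01 : 0 <= rho <= 1)
    (beta_rho : beta + rho = 1) (q0_ge0 : 0 <= q0)
    (HC : linearized_cooperator_wealth gain loss v beta rho q0 C) :
  let m := v * (beta * gain - rho * loss) in
  let sigma2 := v * (beta * gain ^+ 2 + rho * loss ^+ 2) in
  (forall eta t : R, 0 < eta -> 0 <= t ->
     ((1 - eta ^- 2)%:E <=
      P [set w | (q0 + m * t - eta * Num.sqrt (sigma2 * t) <= C t w <=
                  q0 + m * t + eta * Num.sqrt (sigma2 * t))%R])%E) /\
  (0 < m ->
   forall eta t tau : R, 0 < eta -> 0 <= t ->
     tau < q0 - eta ^+ 2 * sigma2 / (4 * m) ->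
     ((1 - eta ^- 2)%:E <= P [set w | (tau < C t w)%R])%E).
Proof.
have /andP[beta_ge0 _] := beta01; have /andP[rho_ge0 _] := rho01.
move=> m sigma2.
have concentration (eta t : R) (eta0 : 0 < eta) (t0 : 0 <= t) :=
  wealth_concentration P gain loss v beta rho q0 C eta t gain_gt0 loss_gt0 v_gt0
    beta_ge0 rho_ge0 beta_rho HC eta0 t0.
split=> [//|m0 eta t tau eta0 t0 tau_lt].
have sigma2_ge0 : 0 <= sigma2.
  by rewrite mulr_ge0 ?(ltW v_gt0) // addr_ge0 // mulr_ge0 ?sqr_ge0.
apply: le_trans (concentration eta t eta0 t0) _.
rewrite -/m -/sigma2.
(* Complete the square in [Num.sqrt t]. *)
have drift_ge : - (eta ^+ 2 * sigma2 / (4 * m)) <=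
    m * t - eta * Num.sqrt (sigma2 * t).
  rewrite sqrtrM //.
  have -> : m * t = m * Num.sqrt t ^+ 2 by rewrite sqr_sqrtr.
  rewrite -{1}(sqr_sqrtr sigma2_ge0) -subr_ge0.
  set s := Num.sqrt sigma2; set y := Num.sqrt t.
  have -> : m * y ^+ 2 - eta * (s * y) - - (eta ^+ 2 * s ^+ 2 / (4 * m)) =
      m * (y - eta * s / (2 * m)) ^+ 2 by field; rewrite gt_eqF.
  by rewrite mulr_ge0 ?sqr_ge0 // ltW.
apply: le_measure; rewrite ?inE.
- rewrite [X in measurable X](_ : _ = C t @^-1` `[q0 + m * t - eta *
    Num.sqrt (sigma2 * t), q0 + m * t + eta * Num.sqrt (sigma2 * t)]).
    exact: measurable_funPTI.
  by apply/seteqP; split=> w; rewrite /= in_itv.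
- rewrite [X in measurable X](_ : _ = C t @^-1` `]tau, +oo[).
    exact: measurable_funPTI.
  by apply/seteqP; split=> w; rewrite /= in_itv /= andbT.
by move=> w /= /andP[+ _]; apply: lt_le_trans; apply: lt_le_trans tau_lt _; lra.
Qed.
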